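(* Let $G=(X\cup Y,E)$ be a bipartite chain graph on $n$ vertices with chain ordering $\sigma_X=(x_1,\dots,x_{n_1})$ and $\sigma_Y=(y_1,\dots,y_{n_2})$, i.e. $N(x_{n_1})\subseteq N(x_{n_1-1})\subseteq\cdots\subseteq N(x_1)$ and $N(y_{n_2})\subseteq N(y_{n_2-1})\subseteq\cdots\subseteq N(y_1)$. Let $j$ be the maximum index such that $x_jy_j\in E$. Then $$Tr(G)+Tr(\overline{G})=\begin{cases} n+2 & \text{if } x_{j+1}y_j\in E \text{ and } x_jy_{j+1}\in E,\\ n+1 & \text{otherwise.}\end{cases}$$
   Context: All graphs are finite and simple; $\overline{G}$ is the complement of $G$. For disjoint $A,B\subseteq V$, $A$ dominates $B$ if every vertex of $B$ is adjacent to at least one vertex of $A$. A transitive $k$-partition of $G=(V,E)$ is a partition $\{V_1,\dots,V_k\}$ of $V$ into $k$ nonempty parts such that $V_i$ dominates $V_j$ for all $1\le i<j\le k$; the transitivity $Tr(G)$ is the maximum such $k$. A bipartite chain graph is a bipartite graph admitting orderings of its two sides as described in the claim. *)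

(* Defs.v *)
(* A finite simple graph on T : finType is given by its adjacency
   relation e : rel T, assumed symmetric and irreflexive. *)
From mathcomp Require Import all_boot.
Set Implicit Arguments.
Unset Strict Implicit.
Unset Printing Implicit Defensive.

Section Transitivity.
Variables (T : finType) (e : rel T).

Definition compl_rel : rel T := [rel u v | (u != v) && ~~ e u v].

Definition neigh (u : T) : {set T} := [set v | e u v].

Definition dominates (A B : {set T}) : bool :=
  [forall v in B, exists u in A, e u v].

(* Injectivity of V makes the k parts distinct; the library's [partition]
   includes their nonemptiness. *)
Definition transitive_partition (k : nat) (V : {ffun 'I_k -> {set T}}) : bool :=
  [&& partition [set V i | i : 'I_k] [set: T],
      injectiveb V &
      [forall i : 'I_k, forall j : 'I_k, (i < j) ==> dominates (V i) (V j)]].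

Definition has_transitive_partition (k : nat) : bool :=
  [exists V : {ffun 'I_k -> {set T}}, transitive_partition V].

(* The bound k <= #|T| loses nothing: see [leq_Tr]. *)
Definition Tr : nat := \max_(k < #|T|.+1 | has_transitive_partition k) k.

Lemma transitive_partition_leq_card k (V : {ffun 'I_k -> {set T}}) :
  transitive_partition V -> k <= #|T|.
Proof.
case/and3P=> parV /injectiveP injV _.
have := card_imset 'I_k injV; rewrite card_ord => <-.
rewrite -cardsT (card_partition parV) -sum1_card.
apply: leq_sum => A AV; rewrite card_gt0.
by case/and3P: parV => _ _; apply: contraNneq => <-.
Qed.

Lemma leq_Tr k : has_transitive_partition k -> k <= Tr.
Proof.
move=> hk; have [V /transitive_partition_leq_card lek] := existsP hk.
exact: (@leq_bigmax_cond _ (fun k : 'I_#|T|.+1 => has_transitive_partition k)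
          (fun k => k : nat) (Ordinal (lek : k < #|T|.+1))).
Qed.

Lemma has_transitive_partition_Tr : 0 < #|T| -> has_transitive_partition Tr.
Proof.
move=> T_gt0.
have h1 : has_transitive_partition 1.
  apply/existsP; exists [ffun=> [set: T]]; apply/and3P; split.
  - have -> : [set [ffun=> [set: T]] i | i : 'I_1] = [set [set: T]].
      apply/setP=> A; rewrite inE; apply/imsetP/eqP => [[i _ ->]|->].
        by rewrite ffunE.
      by exists ord0; rewrite ?ffunE.
    by rewrite /partition /cover big_set1 eqxx trivIset1 inE eq_sym
               -card_gt0 cardsT T_gt0.
  - by apply/injectiveP=> i j _; rewrite !ord1.
  - by apply/forallP=> i; apply/forallP=> j; rewrite !ord1.
rewrite /Tr (bigmax_eq_arg (Ordinal (T_gt0 : 1 < #|T|.+1))) //.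
by case: arg_maxnP.
Qed.

End Transitivity.

Section ChainGraph.
Variables (T : finType) (e : rel T).

Definition bipartition (X Y : {set T}) : Prop :=
  [/\ X :|: Y = [set: T], [disjoint X & Y],
      {in X &, forall u v, ~~ e u v} & {in Y &, forall u v, ~~ e u v}].

Definition enumerates (m : nat) (z : 'I_m -> T) (Z : {set T}) : Prop :=
  injective z /\ [set z i | i : 'I_m] = Z.

Definition nested_neigh (m : nat) (z : 'I_m -> T) : Prop :=
  forall i k : 'I_m, i <= k -> neigh e (z k) \subset neigh e (z i).

(* Vertices are indexed from 1: x_i is [x a] with a.+1 = i.  The edge x_i y_k
   is absent when i or k is out of range. *)
Definition edge_at (n1 n2 : nat) (x : 'I_n1 -> T) (y : 'I_n2 -> T)
    (i k : nat) : bool :=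
  [exists a : 'I_n1, exists b : 'I_n2,
     [&& a.+1 == i, b.+1 == k & e (x a) (y b)]].

End ChainGraph.

(* Main.v *)
(** A transitive k-partition is a surjective colouring by 0, ..., k-1 in which
    every vertex has a neighbour of each smaller colour.  The vertices x_i, y_i
    with i <= j (the core) form a biclique, and all other vertices are pairwise
    non-adjacent.
    - Complement: Tr = n - j.  The classes {x_i, y_i}, i <= j, followed by
      singletons reach this.  Conversely, for a core vertex v of largest colour,
      every colour occurs outside the j core vertices on the other side, since v
      has no neighbour among them in the complement.
    - G: Tr = j + 1, or j + 2 if both extra edges are present.  The core gives
      the lower bound.  The upper bound is a count of the colours missed by a
      vertex cover, applied to the core, or to the core without y_j (resp. x_j)
      when x_{j+1} y_j (resp. x_j y_{j+1}) is not an edge. *)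
Require Import Defs.
From mathcomp Require Import all_boot.
Set Implicit Arguments.
Unset Strict Implicit.
Unset Printing Implicit Defensive.

(** * Transitive partitions as colourings *)

Definition transitive_coloring (T : finType) (e : rel T) (k : nat)
    (f : T -> nat) : Prop :=
  [/\ forall v, f v < k,
      forall i, i < k -> exists v, f v = i &
      forall v i, i < f v -> exists2 u, f u = i & e u v].

Lemma has_transitive_partitionP (T : finType) (e : rel T) (k : nat) :
  has_transitive_partition e k <-> exists f, transitive_coloring e k f.
Proof.
split=> [/existsP[V /and3P[/and3P[/eqP covV trivV V0] /injectiveP injV domV]]|].
  have V_inj i i' v : v \in V i -> v \in V i' -> i = i'.
    move=> vi vi'; apply: injV; apply/eqP; apply: contraT => neq.
    have /trivIsetP/(_ (V i) (V i') (imset_f _ _) (imset_f _ _) neq) := trivV.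
    by move=> /(_ isT isT) /pred0P/(_ v); rewrite /= vi vi'.
  have /fin_all_exists[f fV] (v : T) : exists i, v \in V i.
    have := in_setT v; rewrite -covV => /bigcupP[_ /imsetP[i _ ->] vi].
    by exists i.
  exists (fun v => nat_of_ord (f v)); split=> [v|i lik|v i lifv].
    exact: ltn_ord.
    have : V (Ordinal lik) != set0.
      by apply: contraNneq V0 => <-; rewrite imset_f.
    by case/set0Pn=> v vi; exists v; rewrite (V_inj _ _ _ (fV v) vi).
  have lik := ltn_trans lifv (ltn_ord (f v)).
  have /forallP/(_ (f v))/implyP/(_ lifv)/forallP/(_ v) :=
    forallP domV (Ordinal lik).
  rewrite fV => /existsP[u /andP[ui euv]]; exists u => //.
  by rewrite (V_inj _ _ _ (fV u) ui).
case=> f [f_lt f_surj f_dom].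
pose V := [ffun i : 'I_k => [set v | f v == i]].
have inV i v : (v \in V i) = (f v == i) by rewrite ffunE inE.
have injV : injective V.
  move=> i i' eqV; have [v fv] := f_surj i (ltn_ord i).
  by apply: val_inj; have := inV i' v; rewrite -eqV inV fv eqxx => /esym/eqP.
apply/existsP; exists V; apply/and3P; split; last 1 first.
- apply/forallP=> i; apply/forallP=> i'; apply/implyP=> lt_i.
  apply/forallP=> v; apply/implyP; rewrite inV => /eqP fv.
  have [|u fu euv] := f_dom v i; first by rewrite fv.
  by apply/existsP; exists u; rewrite inV fu eqxx.
- apply/and3P; split.
  + apply/eqP/setP=> v; rewrite inE; apply/bigcupP.
    exists (V (Ordinal (f_lt v))); first exact: imset_f.
    by rewrite inV.
  + apply/trivIsetP=> _ _ /imsetP[i _ ->] /imsetP[i' _ ->] neq.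
    apply/pred0P=> v /=; rewrite !inV; apply: contraNF neq => /andP[/eqP fv].
    by rewrite fv (inj_eq injV).
  + apply/negP=> /imsetP[i _ /setP V0]; have [v fv] := f_surj i (ltn_ord i).
    by have := V0 v; rewrite inV fv eqxx inE.
- exact/injectiveP.
Qed.

Lemma leq_Tr_coloring (T : finType) (e : rel T) (k : nat) (f : T -> nat) :
  transitive_coloring e k f -> k <= Tr e.
Proof. by move=> col; apply/leq_Tr/has_transitive_partitionP; exists f. Qed.

Lemma Tr_leq (T : finType) (e : rel T) (m : nat) :
  (forall k f, transitive_coloring e k f -> k <= m) -> Tr e <= m.
Proof.
by move=> le_m; apply/bigmax_leqP=> k /has_transitive_partitionP[f /le_m].
Qed.

(** * Upper bounds on the number of colours *)

Section Upper.
Variables (T : finType) (e : rel T) (k : nat) (f : T -> nat).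
Hypothesis (f_col : transitive_coloring e k f).

(** Colours as elements of ['I_k], so that sets of colours can be counted. *)
Let g (v : T) : 'I_k := Ordinal (let: And3 f_lt _ _ := f_col in f_lt v).

(** Of [P] and [Q], the one opposite a vertex of largest colour can be discarded without losing a
    colour; equal sizes make both cases give the same bound. *)
Lemma coloring_card_anticomplete (P Q : {set T}) :
    [disjoint P & Q] -> #|P| = #|Q| -> 0 < #|P| ->
    (forall u v, u \in P -> v \in Q -> ~~ e u v && ~~ e v u) ->
  k + #|P| <= #|T|.
Proof.
case: (f_col) => f_lt f_surj f_dom disPQ eqPQ /card_gt0P[v0 v0P] noE.
have [v vPQ v_max] : exists2 v, v \in P :|: Q
    & forall u, u \in P :|: Q -> f u <= f v.
  have v0PQ : v0 \in P :|: Q by rewrite inE v0P.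
  by case: (arg_maxnP f v0PQ) => v vPQ v_max; exists v.
have main (Q' : {set T}) : Q' \subset P :|: Q -> v \notin Q' ->
    (forall u, u \in Q' -> ~~ e u v) -> k + #|Q'| <= #|T|.
  move=> sQ' vQ' noQ'; rewrite -(cardsC Q') addnC leq_add2l.
  have <- : #|[set: 'I_k]| = k by rewrite cardsT card_ord.
  apply: leq_trans (leq_imset_card g _); apply: subset_leq_card.
  apply/subsetP=> i _; apply/imsetP.
  (* Smaller colours occur among the neighbours of [v], none of which is in [Q']; larger ones occur
     only outside [P :|: Q], by the choice of [v]. *)
  have [lt_i|lt_i|eq_i] := ltngtP i (f v).
  - have [u fu euv] := f_dom v i lt_i; exists u; last exact: val_inj.
    by rewrite inE; apply: contraL euv => /noQ'.
  - have [u fu] := f_surj i (ltn_ord i); exists u; last exact: val_inj.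
    rewrite inE; apply: contraL lt_i => uQ'.
    by rewrite -leqNgt -fu v_max // (subsetP sQ').
  - by exists v; [rewrite inE | apply: val_inj].
case/setUP: (vPQ) => [vP|vQ].
  rewrite eqPQ; apply: main; first exact: subsetUr.
    by rewrite (disjointFr disPQ vP).
  by move=> u uQ; case/andP: (noE v u vP uQ).
apply: main; first exact: subsetUl.
  by rewrite (disjointFl disPQ vQ).
by move=> u uP; case/andP: (noE u v uP vQ).
Qed.

(* A vertex of top colour and a neighbour of it of the next colour see, between
   them, every colour but one on each side. *)
Lemma coloring_leq_card_side (Z : {set T}) :
    (forall u v, e u v -> (u \in Z) != (v \in Z)) ->
  k <= #|g @: Z|.+1.
Proof.
case: (f_col) => f_lt f_surj f_dom Zbip.
case: (leqP k 1) => [k_le1|k_gt1]; first exact: leq_trans k_le1 _.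
have lt1 : k.-1 < k by rewrite ltn_predL ltnW.
have [v fv] := f_surj _ lt1.
have [u fu euv] : exists2 u, f u = k.-2 & e u v.
  by apply: f_dom; rewrite fv; case: (k) k_gt1 => [|[]].
(* [i0] is the one colour that [Z] may miss. If [v] is in [Z], it carries the top colour, and the
   neighbours of [u], all in [Z], supply those below [k.-2]; otherwise the neighbours of [v] supply
   all colours below [k.-1]. *)
have [i0 i0P] : exists i0 : nat,
    forall i : 'I_k, i != i0 :> nat -> i \in g @: Z.
  have [vZ|vZ] := boolP (v \in Z).
    exists k.-2 => i i_neq; have [eq_i|neq_i] := eqVneq (i : nat) k.-1.
      by apply/imsetP; exists v => //; apply: val_inj; rewrite /= fv.
    have lt_i : i < f u.
      rewrite fu; case: (k) k_gt1 i i_neq neq_i => [|[|m]] //= _ i.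
      move=> i1 i2; have := ltn_ord i.
      by rewrite ltnS leq_eqVlt (negPf i2) ltnS leq_eqVlt (negPf i1).
    have [w fw ewu] := f_dom _ _ lt_i; apply/imsetP; exists w.
      have := Zbip _ _ ewu; have := Zbip _ _ euv; rewrite vZ.
      by case: (u \in Z) (w \in Z) => [] [].
    exact: val_inj.
  exists k.-1 => i i_neq.
  have lt_i : i < f v.
    by rewrite fv ltn_neqAle i_neq -ltnS prednK ?ltn_ord // ltnW.
  have [w fw ewv] := f_dom _ _ lt_i; apply/imsetP; exists w.
    by have := Zbip _ _ ewv; rewrite (negPf vZ); case: (w \in Z).
  exact: val_inj.
have := cardsC (g @: Z); rewrite card_ord => {1}<-.
rewrite -addn1 leq_add2l; apply/card_le1_eqP => i i'.
rewrite !in_setC => iZ i'Z.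
have eq_i0 (l : 'I_k) : l \notin g @: Z -> l = i0 :> nat.
  by move=> lZ; apply/eqP; apply: contraR lZ => /i0P.
by apply: val_inj; rewrite /= !eq_i0.
Qed.

(* If a colour class meets X but not A, every lower class meets B, and
   symmetrically.  So if both A' and B' (the colours missed by the cover on either
   side) are nonempty, then they are the same singleton. *)
Lemma coloring_leq_cover (X A B : {set T}) :
    symmetric e -> (forall u v, e u v -> (u \in X) != (v \in X)) ->
    (forall u v, u \in X -> e u v -> (u \in A) || (v \in B)) ->
  [|| k <= #|A|.+1, k <= #|B|.+1 | k <= (minn #|A| #|B|).+2].
Proof.
case: (f_col) => f_lt f_surj f_dom e_sym Xbip cov.
pose A' := g @: X :\: g @: A; pose B' := g @: (~: X) :\: g @: B.
have leX : k <= (#|A| + #|A'|).+1.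
  apply: leq_trans (coloring_leq_card_side Xbip) _; rewrite ltnS.
  rewrite -(cardsID (g @: A)) leq_add // (leq_trans _ (leq_imset_card g A)) //.
  exact/subset_leq_card/subsetIr.
have leY : k <= (#|B| + #|B'|).+1.
  have := @coloring_leq_card_side (~: X); move/(_ _)/leq_trans; apply.
    by move=> u v /Xbip; rewrite !inE; case: (_ \in X) (_ \in X) => [] [].
  rewrite ltnS -(cardsID (g @: B)) leq_add //.
  rewrite (leq_trans _ (leq_imset_card g B)) //.
  exact/subset_leq_card/subsetIr.
(* An empty [A'] or [B'] turns [leX] or [leY] into one of the first two alternatives; otherwise each
   has one element, which gives the third. *)
have [A0|[a aA']] := set_0Vmem A'.
  by rewrite A0 cards0 addn0 in leX; rewrite leX.
have [B0|[b bB']] := set_0Vmem B'.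
  by rewrite B0 cards0 addn0 in leY; rewrite leY orbT.
have leAB c d : c \in A' -> d \in B' -> c <= d.
  case/setDP=> /imsetP[u uX ->] uA /setDP[_ dB]; rewrite leqNgt.
  apply: contra dB => lt_d; have [w fw ewu] := f_dom _ _ lt_d.
  have /orP[uA'|wB] : (u \in A) || (w \in B) by apply: cov; rewrite // e_sym.
    by rewrite imset_f in uA.
  by apply/imsetP; exists w => //; apply: val_inj.
have leBA c d : c \in A' -> d \in B' -> d <= c.
  move=> /setDP[_ cA] /setDP[/imsetP[v vX ->] vB]; rewrite leqNgt.
  apply: contra cA => lt_c; have [w fw ewv] := f_dom _ _ lt_c.
  have wX : w \in X.
    by have := Xbip _ _ ewv; move: vX; rewrite inE => /negPf->; case: (w \in X).
  have /orP[wA|vB'] := cov _ _ wX ewv; last by rewrite imset_f in vB.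
  by apply/imsetP; exists w => //; apply: val_inj.
have eqAB c d : c \in A' -> d \in B' -> c = d.
  by move=> cA dB; apply/val_inj/eqP; rewrite eqn_leq leAB ?leBA.
have A1 : #|A'| <= 1.
  apply/card_le1_eqP => c d cA dA.
  by rewrite (eqAB _ _ cA bB') (eqAB _ _ dA bB').
have B1 : #|B'| <= 1.
  apply/card_le1_eqP => c d cB dB.
  by rewrite -(eqAB _ _ aA' cB) (eqAB _ _ aA' dB).
have leX1 : k <= #|A|.+2
  by apply: leq_trans leX _; rewrite ltnS -addn1 leq_add2l.
have leY1 : k <= #|B|.+2
  by apply: leq_trans leY _; rewrite ltnS -addn1 leq_add2l.
by rewrite -!minnSS leq_min leX1 leY1 !orbT.
Qed.

End Upper.

(** * Transitivity of the graph and its complement in terms of levels *)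

(* [lv v] is the 0-based position of v in the chain ordering of its side. *)
Section Levels.
Variables (T : finType) (e : rel T) (X : {set T}) (lv : T -> nat) (j : nat).
Hypotheses (e_sym : symmetric e)
  (Xbip : forall u v, e u v -> (u \in X) != (v \in X))
  (lv_inj : forall u v, (u \in X) = (v \in X) -> lv u = lv v -> u = v)
  (lv_surj : forall s i, i < j -> exists u, (u \in X) = s /\ lv u = i)
  (lv_low : forall u v, (u \in X) != (v \in X) -> lv u < j -> lv v < j -> e u v)
  (lv_high : forall u v, e u v -> j <= lv u -> lv v < j)
  (j_gt0 : 0 < j).

Let side (s : bool) (i : nat) : {set T} :=
  [set u | ((u \in X) == s) && (lv u < i)].

Lemma card_side s i : i <= j -> #|side s i| = i.
Proof.
move=> le_ij.
have /fin_all_exists[z zP] (a : 'I_i) : exists u, (u \in X) = s /\ lv u = a.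
  by apply: lv_surj; apply: leq_trans le_ij.
have z_inj : injective z.
  move=> a b eqz; apply: val_inj; have [_ la] := zP a; have [_ lb] := zP b.
  by rewrite /= -la -lb eqz.
suff -> : side s i = z @: setT by rewrite card_imset // cardsT card_ord.
apply/setP=> u; rewrite inE; apply/andP/imsetP => [[/eqP us lt_u]|[a _ ->]].
  exists (Ordinal lt_u) => //; have [zs zl] := zP (Ordinal lt_u).
  by apply: lv_inj; rewrite ?us ?zs ?zl.
by have [-> ->] := zP a; rewrite eqxx.
Qed.

Lemma side_disjoint : [disjoint side true j & side false j].
Proof.
by apply/pred0P=> u; rewrite /= !inE; case: (u \in X); rewrite ?andbF.
Qed.

Lemma Tr_compl_levels : Tr (compl_rel e) + j = #|T|.
Proof.
pose R := [set v | j <= lv v].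
have cardT : #|T| = j + #|R| + j.
  rewrite -(cardsC R) -addnA addnCA; congr (_ + _).
  have -> : ~: R = side true j :|: side false j.
    by apply/setP=> u; rewrite !inE -ltnNge; case: (u \in X); rewrite ?orbF.
  rewrite cardsU (eqP (_ : side true j :&: side false j == set0)).
    by rewrite cards0 subn0 !card_side.
  by rewrite setI_eq0 side_disjoint.
apply/eqP; rewrite eqn_leq; apply/andP; split.
  have leT k f : transitive_coloring (compl_rel e) k f -> k <= #|T| - j.
    move=> col; rewrite leq_subRL; last by rewrite cardT leq_addl.
    rewrite addnC -{1}(@card_side true j) //.
    apply: (coloring_card_anticomplete col side_disjoint); rewrite ?card_side //.
    move=> u v; rewrite !inE => /andP[/eqP uX lt_u] /andP[/eqP vX lt_v].
    by rewrite /compl_rel /= !lv_low ?uX ?vX // !andbF.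
  rewrite addnC -leq_subRL; first exact: Tr_leq.
  by rewrite cardT leq_addl.
rewrite cardT leq_add2r.
(* Core vertices are coloured by level; each vertex of [R] gets a colour of its own, [j] plus its
   position in [enum R]. *)
pose f v := if lv v < j then lv v else j + index v (enum R).
(* A colour below [j] is found on the side of [v] itself, which is a clique in the complement. *)
have dom0 v i : i < lv v -> i < j -> exists2 u, f u = i & compl_rel e u v.
  move=> lt_v lt_j; have [u [us ul]] := lv_surj (v \in X) lt_j.
  exists u; first by rewrite /f ul lt_j.
  rewrite /compl_rel /= (contraTN (@Xbip u v)) ?us ?eqxx // andbT.
  by apply: contraTneq lt_v => <-; rewrite ul ltnn.
have inR v : j <= lv v -> index v (enum R) < #|R|.
  by move=> le_v; rewrite cardE index_mem mem_enum inE.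
have surjR i : j <= i -> i < j + #|R| ->
    exists u, [/\ f u = i, j <= lv u & index u (enum R) = i - j].
  move=> le_ji lt_i; have lt_ij : i - j < #|R|.
    by rewrite ltn_subLR.
  have /card_gt0P[v0 _] : 0 < #|R| by apply: leq_ltn_trans lt_ij.
  have := lt_ij; rewrite cardE => lt_size.
  have := mem_nth v0 lt_size; rewrite mem_enum inE => le_u.
  exists (nth v0 (enum R) (i - j)).
  by rewrite /f ltnNge le_u index_uniq ?enum_uniq // subnKC.
apply: (@leq_Tr_coloring _ _ _ f); split=> [v|i lt_i|v i].
- rewrite /f; case: (ltnP (lv v) j) => [lt_v|le_v]; last first.
    by rewrite ltn_add2l inR.
  exact: ltn_addr.
- have [lt_j|le_j] := ltnP i j; last first.
    by have [u []] := surjR _ le_j lt_i; exists u.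
  by have [u [_ ul]] := lv_surj true lt_j; exists u; rewrite /f ul lt_j.
- have [lt_j|le_j] := ltnP i j.
    move=> lt_v; apply: dom0 => //; move: lt_v; rewrite /f.
    by case: (ltnP (lv v) j) => // le_v _; apply: leq_trans le_v.
  rewrite /f; case: (ltnP (lv v) j) => [lt_v lt_i|le_v lt_i].
    by have := ltn_trans lt_i lt_v; rewrite ltnNge le_j.
  have [u [fu le_u iu]] : exists u,
      [/\ f u = i, j <= lv u & index u (enum R) = i - j].
    by apply: surjR; rewrite // (ltn_trans lt_i) // ltn_add2l inR.
  have neuv : ~~ e u v by apply/negP=> /lv_high/(_ le_u); rewrite ltnNge le_v.
  exists u => //; rewrite /compl_rel /= neuv andbT.
  by apply: contraTneq lt_i => <-; rewrite iu subnKC // ltnn.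
Qed.

Lemma Tr_levels_ge (c : bool) :
    (c -> forall v, lv v < j -> exists2 u, lv u = j & e u v) ->
  j.+1 + c <= Tr e.
Proof.
move=> c_edge.
(* The classes are, in order: the pair of level j together with everything left
   over (only if c), the pairs of levels 0, ..., j - 2, and the two vertices of
   level j - 1, the one in X first.  If ~~ c, the leftovers go to class 0. *)
pose f v :=
  if lv v < j then c + (lv v + ((v \notin X) && (lv v == j.-1))) else 0.
have f_dom v i : i < f v -> exists2 u, f u = i & e u v.
  rewrite {1}/f; case: (ltnP (lv v) j) => // lt_v lt_i.
  (* [i < c] forces [c] to be true and [i] to be 0; [c_edge] then gives a neighbour on level [j],
     which has colour 0. *)
  have [lt_c|le_c] := ltnP i c.
    case: c c_edge @f lt_i lt_c => // /(_ isT v lt_v)[u ul euv] f _.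
    by rewrite ltnS leqn0 => /eqP->; exists u; rewrite // /f ul ltnn.
  pose i' := i - c; have def_i : i = c + i' by rewrite subnKC.
  rewrite def_i ltn_add2l in lt_i *.
  have lt_j : i' < j.
    apply: leq_trans lt_i _.
    have [_|_] := boolP (v \notin X); last by rewrite addn0 ltnW.
    case: eqVneq => [->|_]; last by rewrite addn0 ltnW.
    by rewrite addn1 prednK.
  (* The neighbour is sought opposite [v], on level [i']. It has colour [c + i'] exactly: either it
     is in [X], or [v] is and then [i' < lv v] keeps it below level [j.-1]. *)
  have [u [us ul]] := lv_surj (v \notin X) lt_j; exists u.
    rewrite /f ul lt_j us negbK; case: (boolP (v \in X)) lt_i => //= vX.
      rewrite addn0 => lt_i; rewrite ltn_eqF ?addn0 //.
      by rewrite (leq_trans lt_i) // -ltnS prednK.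
    by rewrite addn0.
  by rewrite lv_low ?ul // us; case: (v \in X).
apply: (@leq_Tr_coloring _ _ _ f); split=> // [v|i].
  rewrite /f; case: (ltnP (lv v) j) => // lt_v.
  rewrite addnC addSn ltnS leq_add2r.
  case: eqVneq => [->|]; last by rewrite andbF addn0 ltnW.
  by rewrite -[leqRHS](prednK j_gt0) -addn1 leq_add2l leq_b1.
have lt_j : j.-1 < j by rewrite prednK.
(* [y] carries the top colour [j + c], so all smaller colours occur among its neighbours. *)
have [y [yX yl]] := lv_surj false lt_j.
have fy : f y = j + c by rewrite /f yl lt_j yX eqxx addn1 prednK // addnC.
rewrite addSn ltnS leq_eqVlt => /predU1P[->|lt_i]; first by exists y.
by have [u fu _] := f_dom y i (leq_trans lt_i (eq_leq (esym fy))); exists u.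
Qed.

(** The cover consists of the first [a] vertices of [X] and the first [b] outside it; the first two
    alternatives of [coloring_leq_cover] are absorbed by [j.+1]. *)
Lemma Tr_levels_le (a b : nat) : a <= j -> b <= j ->
    (forall u v, u \in X -> e u v -> (lv u < a) || (lv v < b)) ->
  Tr e <= maxn j.+1 (minn a b).+2.
Proof.
move=> le_a le_b cov; apply: Tr_leq => k f col.
have := @coloring_leq_cover _ _ _ _ col X (side true a) (side false b).
rewrite !card_side // leq_max => /(_ e_sym Xbip)/(_ _)/or3P[].
- move=> u v uX euv; rewrite !inE uX.
  by have := Xbip euv; rewrite uX; case: (v \in X) => //= _; apply: cov.
- by move=> le_k; rewrite (leq_trans le_k).
- by move=> le_k; rewrite (leq_trans le_k).
- by move=> ->; rewrite orbT.
Qed.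

End Levels.

(** * From the chain orderings to levels *)

Lemma index_codom_inj (T : eqType) (m : nat) (z : 'I_m -> T) (a : 'I_m) :
  injective z -> index (z a) (codom z) = a.
Proof. by move=> z_inj; rewrite /codom index_map // index_enum_ord. Qed.

Theorem theorem3 (T : finType) (e : rel T) (X Y : {set T}) (n n1 n2 j : nat)
    (x : 'I_n1 -> T) (y : 'I_n2 -> T)
    (e_sym : symmetric e) (e_irr : irreflexive e)
    (XY_bip : bipartition e X Y) (T_card : #|T| = n)
    (x_enum : enumerates x X) (y_enum : enumerates y Y)
    (x_chain : nested_neigh e x) (y_chain : nested_neigh e y)
    (j_edge : edge_at e x y j j)
    (j_max : forall i : nat, edge_at e x y i i -> i <= j) :
  Tr e + Tr (compl_rel e) =
    if edge_at e x y j.+1 j && edge_at e x y j j.+1 then n + 2 else n + 1.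
Proof.
have [XY_T XY_dis X_ind Y_ind] := XY_bip.
have [[x_inj x_im] [y_inj y_im]] := (x_enum, y_enum).
have xX a : x a \in X by rewrite -x_im imset_f.
have yX b : (y b \in X) = false by rewrite (disjointFl XY_dis) // -y_im imset_f.
have vertexP v : (exists a, v = x a) \/ (exists b, v = y b).
  have := in_setT v; rewrite -XY_T -x_im -y_im.
  by case/setUP=> /imsetP[a _ ->]; [left | right]; exists a.
pose lv v := if v \in X then index v (codom x) else index v (codom y).
have lvx a : lv (x a) = a by rewrite /lv xX index_codom_inj.
have lvy b : lv (y b) = b by rewrite /lv yX index_codom_inj.
(* Lowering either index preserves edges: the adjacency matrix has the shape of a Ferrers
   diagram. *)
have mono (a a' : 'I_n1) (b b' : 'I_n2) :
    a' <= a -> b' <= b -> e (x a) (y b) -> e (x a') (y b').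
  move=> le_a le_b eab.
  have /subsetP/(_ (y b)) := x_chain a' a le_a; rewrite !inE => /(_ eab) ea'b.
  have /subsetP/(_ (x a')) := y_chain b' b le_b; rewrite !inE ![e (y _) _]e_sym.
  exact.
have edge_atI i k (a : 'I_n1) (b : 'I_n2) :
    a = i :> nat -> b = k :> nat -> e (x a) (y b) -> edge_at e x y i.+1 k.+1.
  move=> ai bk eab; apply/existsP; exists a; apply/existsP; exists b.
  by rewrite ai bk !eqxx.
have [aj [bj [aj_j bj_j eab]]] :
    exists (a : 'I_n1) (b : 'I_n2), [/\ a.+1 = j, b.+1 = j & e (x a) (y b)].
  case/existsP: j_edge => a /existsP[b /and3P[/eqP ? /eqP ? ?]].
  by exists a, b.
have j_gt0 : 0 < j by rewrite -aj_j.
have jE : j = j.-1.+1 by rewrite prednK.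
have Xbip u v : e u v -> (u \in X) != (v \in X).
  case: (vertexP u) => -[i ->]; case: (vertexP v) => -[k ->]; rewrite ?xX ?yX //.
    by rewrite (negPf (X_ind _ _ _ _)).
  by rewrite (negPf (Y_ind _ _ _ _)) // -y_im imset_f.
have lv_inj u v : (u \in X) = (v \in X) -> lv u = lv v -> u = v.
  case: (vertexP u) => -[i ->]; case: (vertexP v) => -[k ->];
    by rewrite ?xX ?yX ?lvx ?lvy // => _ /val_inj->.
have lv_surj s i : i < j -> exists u, (u \in X) = s /\ lv u = i.
  move=> lt_i; case: s.
    have lt_i1 : i < n1 by rewrite (leq_trans lt_i) // -aj_j.
    by exists (x (Ordinal lt_i1)); rewrite xX lvx.
  have lt_i2 : i < n2 by rewrite (leq_trans lt_i) // -bj_j.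
  by exists (y (Ordinal lt_i2)); rewrite yX lvy.
have lv_low_xy (a : 'I_n1) (b : 'I_n2) : a < j -> b < j -> e (x a) (y b).
  by move=> lt_a lt_b; apply: mono eab; rewrite -ltnS ?aj_j ?bj_j.
have lv_low u v : (u \in X) != (v \in X) -> lv u < j -> lv v < j -> e u v.
  case: (vertexP u) => -[i ->]; case: (vertexP v) => -[k ->];
    rewrite ?xX ?yX ?lvx ?lvy // => _ lt_i lt_k; last rewrite e_sym;
    exact: lv_low_xy.
(* By [mono], such an edge would yield the edge between [x_{j+1}] and [y_{j+1}], against the
   maximality of [j]. *)
have lv_high_xy (a : 'I_n1) (b : 'I_n2) :
    e (x a) (y b) -> j <= a -> j <= b -> False.
  move=> eab' le_a le_b; have lt_j1 := leq_ltn_trans le_a (ltn_ord a).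
  have lt_j2 := leq_ltn_trans le_b (ltn_ord b).
  have := j_max j.+1; rewrite ltnn => /(_ _)/negP; apply=> //.
  apply: (edge_atI j j (Ordinal lt_j1) (Ordinal lt_j2)) => //.
  exact: mono eab'.
have lv_high u v : e u v -> j <= lv u -> lv v < j.
  move=> euv le_u; rewrite ltnNge; apply/negP => le_v.
  have := Xbip _ _ euv; move: euv le_u le_v.
  case: (vertexP u) => -[i ->]; case: (vertexP v) => -[k ->];
    rewrite ?xX ?yX ?lvx ?lvy // => eik le_i le_k _.
    exact: lv_high_xy eik le_i le_k.
  by rewrite e_sym in eik; apply: lv_high_xy eik le_k le_i.
have Tr_le := Tr_levels_le e_sym Xbip lv_inj lv_surj.
have Tr_ge := Tr_levels_ge lv_surj lv_low j_gt0.
have Tr_compl := Tr_compl_levels Xbip lv_inj lv_surj lv_low lv_high j_gt0.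
have cov_jj u v : u \in X -> e u v -> (lv u < j) || (lv v < j).
  by move=> _ euv; case: ltnP => //= /(lv_high _ _ euv).
suff -> : Tr e = j.+1 + (edge_at e x y j.+1 j && edge_at e x y j j.+1).
  rewrite -T_card -Tr_compl; case: ifP => _; rewrite addnC !addnA ?addn0.
    by rewrite -addnA addSnnS addnA.
  by rewrite -addn1 addnA.
(* For the lower bound, the level-[j] neighbours are [y_{j+1}] for core vertices in [X] and
   [x_{j+1}] for those in [Y], again by [mono]. *)
apply/eqP; rewrite eqn_leq Tr_ge ?andbT; last first.
  case/andP=> /existsP[a /existsP[b /and3P[/eqP[ja] /eqP jb eab1]]].
  case/existsP=> a' /existsP[b' /and3P[/eqP ja' /eqP[jb'] eab2]] v.
  case: (vertexP v) => -[i ->]; rewrite ?lvx ?lvy => lt_i.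
    exists (y b'); rewrite ?lvy // e_sym; apply: mono eab2 => //.
    by rewrite -ltnS ja'.
  by exists (x a); rewrite ?lvx //; apply: mono eab1; rewrite // -ltnS jb.
have [e1|ne1] /= := boolP (edge_at e x y j.+1 j); last first.
  rewrite addn0; have := Tr_le j j.-1; rewrite (minn_idPr (leq_pred j)).
  rewrite -jE maxnn; apply=> //; first exact: leq_pred.
  (* An edge missed by the cover without [y_j] would join [y_j] to some [x_i] with [i > j], hence
     also to [x_{j+1}]. *)
  move=> u v uX euv; case: ltnP => //= le_u; have lt_v := lv_high _ _ euv le_u.
  rewrite ltn_neqAle -ltnS -jE lt_v andbT; apply: contra ne1 => /eqP lv_v.
  have := Xbip _ _ euv; move: uX euv le_u lv_v {lt_v}.
  case: (vertexP u) => -[a ->]; case: (vertexP v) => -[b ->];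
    rewrite ?xX ?yX ?lvx ?lvy // => _ eab' le_a jb _.
  have lt_j := leq_ltn_trans le_a (ltn_ord a).
  rewrite {2}jE; apply: (edge_atI _ _ (Ordinal lt_j) b) => //.
  exact: mono eab'.
have [e2|ne2] := boolP (edge_at e x y j j.+1); last first.
  rewrite addn0; have := Tr_le j.-1 j; rewrite (minn_idPl (leq_pred j)).
  rewrite -jE maxnn; apply=> //; first exact: leq_pred.
  move=> u v uX euv; rewrite orbC; case: ltnP => //= le_v.
  rewrite e_sym in euv; have lt_u := lv_high _ _ euv le_v.
  rewrite ltn_neqAle -ltnS -jE lt_u andbT; apply: contra ne2 => /eqP lv_u.
  have := Xbip _ _ euv; move: uX euv le_v lv_u {lt_u}.
  case: (vertexP u) => -[a ->]; case: (vertexP v) => -[b ->];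
    rewrite ?xX ?yX ?lvx ?lvy // => _ eab' le_b ja _.
  rewrite e_sym in eab'.
  have lt_j := leq_ltn_trans le_b (ltn_ord b).
  rewrite {1}jE; apply: (edge_atI _ _ a (Ordinal lt_j)) => //.
  exact: mono eab'.
by rewrite addn1 (leq_trans (Tr_le j j _ _ cov_jj)) // minnn geq_max leqnSn leqnn.
Qed.
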